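(* Let $G$ be a countable abelian group written as the union of an increasing sequence of finitely generated subgroups $G_i$, and let $H$ be an abelian group. Then the Jensen isomorphism $$\mathrm{Pext}^1_{\mathbb Z}(G,H)\xrightarrow{\ \cong\ }\varprojlim{}^1\,\mathrm{Hom}_{\mathbb Z}(G_i,H)$$ is an isomorphism of topological groups.
   Context: $\mathrm{Pext}^1_{\mathbb Z}(G,H)\subseteq\mathrm{Ext}^1_{\mathbb Z}(G,H)$ is the subgroup of classes of pure extensions $0\to H\to E\to G\to0$ ($H\cap nE=nH$ for all $n\ge1$). Groups $G,G_i,H$ are discrete; Hom groups have the topology of pointwise convergence. $\mathrm{Ext}^1_{\mathbb Z}(G,H)$ is topologized, for an injective resolution $0\to H\to I\to I'\to 0$, by the quotient topology on $\mathrm{Hom}_{\mathbb Z}(G,I')/\mathrm{im}\,\mathrm{Hom}_{\mathbb Z}(G,I)$ (the resulting topology does not depend on the resolution), and $\mathrm{Pext}^1_{\mathbb Z}(G,H)$ has the subspace topology. $\varprojlim^1\mathrm{Hom}_{\mathbb Z}(G_i,H)$ is defined by the Eilenberg exact sequence $$0\to\mathrm{Hom}_{\mathbb Z}(G,H)\to\prod_i\mathrm{Hom}_{\mathbb Z}(G_i,H)\xrightarrow{\Psi}\prod_i\mathrm{Hom}_{\mathbb Z}(G_i,H)\to\varprojlim{}^1\mathrm{Hom}_{\mathbb Z}(G_i,H)\to0,$$ $\Psi((f_i)_i)=(f_i-f_{i+1}|_{G_i})_i$; the products have the product topology and $\varprojlim^1$ the quotient topology. The Jensen isomorphism is obtained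 from the canonical pure exact sequence $0\to\bigoplus_iG_i\xrightarrow{\psi}\bigoplus_iG_i\to G\to0$ by applying $\mathrm{Hom}_{\mathbb Z}(-,H)$: the connecting map identifies $\mathrm{coker}(\psi^* )$ with $\mathrm{Pext}^1_{\mathbb Z}(G,H)$, and under $\mathrm{Hom}_{\mathbb Z}(\bigoplus_i G_i,H)\cong\prod_i\mathrm{Hom}_{\mathbb Z}(G_i,H)$ the map $\psi^*$ becomes $\Psi$. *)

(* Defs.v *)
From HB Require Import structures.
From mathcomp Require Import all_boot all_order all_algebra.
From mathcomp Require Import all_classical all_reals all_analysis.
Set Implicit Arguments.
Unset Strict Implicit.
Unset Printing Implicit Defensive.
Import Order.TTheory GRing.Theory Num.Theory.
Local Open Scope classical_set_scope.
Local Open Scope ring_scope.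
Local Open Scope quotient_scope.

Lemma continuous_prod_topology (X : topologicalType) (I : Type)
    (T : I -> topologicalType) (f : X -> prod_topology T) :
  (forall i, continuous (fun x => f x i)) -> continuous f.
Proof.
move=> cf x; apply/cvg_sup => i U [V] [[W oW <-] Wfx WU].
apply: (filterS WU); apply: (cf i x W).
by apply: open_nbhs_nbhs; split.
Qed.

Definition subgrp (G : zmodType) (S : zmodClosed G) : Type := {x : G | x \in S}.

Section subgrp_zmod.
Variables (G : zmodType) (S : zmodClosed G).
HB.instance Definition _ := SubChoice.on (subgrp S).
HB.instance Definition _ := [SubChoice_isSubZmodule of subgrp S by <:].
End subgrp_zmod.

Section subgrp_topology.
Variables (M : topologicalZmodType) (S : zmodClosed M).

HB.instance Definition _ :=
  Topological.copy (subgrp S) (initial_topology (\val : subgrp S -> M)).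

Lemma subgrp_val_continuous : continuous (\val : subgrp S -> M).
Proof. exact: initial_continuous. Qed.

Lemma subgrp_sub_continuous :
  continuous (fun x : subgrp S * subgrp S => x.1 - x.2).
Proof.
apply: (@continuous_comp_initial _ _ _ (\val : subgrp S -> M)) => x.
have -> : \val \o (fun x : subgrp S * subgrp S => x.1 - x.2) =
          (fun y : M * M => y.1 - y.2) \o
            (fun x : subgrp S * subgrp S => (\val x.1, \val x.2)).
  by apply/funext => y; exact: (raddfB (\val : subgrp S -> M)).
apply: continuous_comp; last exact: sub_continuous.
apply: cvg_pair.
  by apply: continuous_comp; [exact: cvg_fst | exact: subgrp_val_continuous].
by apply: continuous_comp; [exact: cvg_snd | exact: subgrp_val_continuous].
Qed.

HB.instance Definition _ :=
  PreTopologicalNmodule_isTopologicalZmodule.Build (subgrp S)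
    subgrp_sub_continuous.

End subgrp_topology.

Definition fin_gen (G : zmodType) (S : zmodClosed G) : Prop :=
  exists (m : nat) (s : m.-tuple G), forall x, x \in S <-> inIntSpan s x.

Section quotient_group.
Variables (M : topologicalZmodType) (S : zmodClosed M).

Definition tquot : Type := quotient_topology (ring_quotient.Quotient.quot S).
HB.instance Definition _ := Topological.on tquot.
HB.instance Definition _ := Quotient.on tquot.
HB.instance Definition _ := let Q := ring_quotient.Quotient.quot S in
  GRing.isZmodule.Build tquot (@addrA Q) (@addrC Q) (@add0r Q) (@addNr Q).

Definition tquot_pi : M -> tquot := \pi_tquot.

Lemma tquot_pi_is_zmod_morphism : zmod_morphism tquot_pi.
Proof. exact: (raddfB (\pi_(ring_quotient.Quotient.quot S))). Qed.

HB.instance Definition _ :=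
  GRing.isZmodMorphism.Build M tquot tquot_pi tquot_pi_is_zmod_morphism.

Lemma tquot_piP (x y : M) : tquot_pi x = tquot_pi y <-> x - y \in S.
Proof.
rewrite ring_quotient.Quotient.idealrBE.
by split=> [e|/eqP e]; [apply/eqP; exact: e | exact: e].
Qed.

Lemma tquot_pi_surj (c : tquot) : exists x, c = tquot_pi x.
Proof. by exists (repr c); rewrite /tquot_pi reprK. Qed.

Lemma tquot_pi_continuous : continuous tquot_pi.
Proof. exact: pi_continuous. Qed.

Lemma tquot_pi_open (U : set M) : open U -> open (tquot_pi @` U).
Proof.
move=> oU.
have -> : open (tquot_pi @` U) = open (tquot_pi @^-1` (tquot_pi @` U)) by [].
have -> : tquot_pi @^-1` (tquot_pi @` U) =
          \bigcup_(s in [set s | s \in S]) ((fun x => x - s) @^-1` U).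
  apply/seteqP; split => [x /= [u Uu /tquot_piP uxS]|x [s /= sS Uxs]].
    by exists (x - u); rewrite /= ?subKr// -opprB rpredN.
  by exists (x - s) => //; apply/tquot_piP; rewrite addrAC subrr sub0r rpredN.
apply: bigcup_open => s _; apply: open_comp => // x _.
apply: (@continuous_comp _ _ _ (fun x => (x, s)) (fun x : M * M => x.1 - x.2)).
  by apply: cvg_pair; [exact: cvg_id | exact: cvg_cst].
exact: sub_continuous.
Qed.

Lemma tquot_pi_nbhs (x : M) (U : set M) :
  nbhs x U -> nbhs (tquot_pi x) (tquot_pi @` U).
Proof.
rewrite nbhsE => -[V [oV Vx] VU].
apply: (@filterS _ _ _ (tquot_pi @` V)); first exact: image_subset.
by apply: open_nbhs_nbhs; split; [exact: tquot_pi_open | exists x].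
Qed.

Lemma tquot_sub_continuous : continuous (fun x : tquot * tquot => x.1 - x.2).
Proof.
move=> [c d] W /= Wcd.
have [x cE] := tquot_pi_surj c; have [y dE] := tquot_pi_surj d.
move: Wcd; rewrite cE dE -raddfB => /tquot_pi_continuous Wxy.
have [[U V] /= [Ux Vy] UVW] := @sub_continuous M (x, y) _ Wxy.
exists (tquot_pi @` U, tquot_pi @` V) => /=.
  by split; exact: tquot_pi_nbhs.
move=> [_ _] /= [[u Uu <-] [v Vv <-]].
by rewrite -raddfB; apply: (UVW (u, v)).
Qed.

HB.instance Definition _ :=
  PreTopologicalNmodule_isTopologicalZmodule.Build tquot tquot_sub_continuous.

End quotient_group.

Section cokernel.
Variables (M : zmodType) (N : topologicalZmodType) (u : {additive M -> N}).

Definition im_pred : {pred N} := fun y => `[< exists x, y = u x >].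

Lemma im_pred_zmod_closed : zmod_closed im_pred.
Proof.
split=> [|y z /asboolP[a ->] /asboolP[b ->]]; apply/asboolP.
  by exists 0; rewrite raddf0.
by exists (a - b); rewrite raddfB.
Qed.

HB.instance Definition _ :=
  GRing.isZmodClosed.Build N im_pred im_pred_zmod_closed.

Definition coker : topologicalZmodType := tquot im_pred.
Definition coker_pi : {additive N -> coker} := @tquot_pi N im_pred.

End cokernel.

Definition HomZ (A B : zmodType) : Type := {additive A -> B}.

Section hom_group.
Variables A B : zmodType.
Implicit Types f g : HomZ A B.

HB.instance Definition _ := gen_eqMixin (HomZ A B).
HB.instance Definition _ := gen_choiceMixin (HomZ A B).

Definition hom_eval f : A -> B := f : {additive A -> B}.

Lemma homP f g : hom_eval f =1 hom_eval g -> f = g.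
Proof.
case: f g => [f [[fP]]] [g [[gP]]] /= /funext; rewrite /hom_eval /= => e.
by subst g; rewrite (Prop_irrelevance fP gP).
Qed.

Definition hom0 : HomZ A B := (\0 : A -> B).
Definition hom_opp f : HomZ A B := (\- hom_eval f)%R.
Definition hom_add f g : HomZ A B := (f \+ g)%R.

Lemma hom_addA : associative hom_add.
Proof. by move=> f g h; apply: homP => x; rewrite /hom_eval /= addrA. Qed.
Lemma hom_addC : commutative hom_add.
Proof. by move=> f g; apply: homP => x; rewrite /hom_eval /= addrC. Qed.
Lemma hom_add0 : left_id hom0 hom_add.
Proof. by move=> f; apply: homP => x; rewrite /hom_eval /= add0r. Qed.
Lemma hom_addN : left_inverse hom0 hom_opp hom_add.
Proof. by move=> f; apply: homP => x; rewrite /hom_eval /= addNr. Qed.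

HB.instance Definition _ :=
  GRing.isZmodule.Build (HomZ A B) hom_addA hom_addC hom_add0 hom_addN.

Lemma homBE f g x : hom_eval (f - g) x = hom_eval f x - hom_eval g x.
Proof. by []. Qed.

End hom_group.

Section hom_topology.
Variables A B : zmodType.

(* B is discrete, and HomZ A B carries the topology of pointwise convergence *)
Definition hom_ptws (f : HomZ A B) : {ptws A -> discrete_topology B} :=
  hom_eval f.

HB.instance Definition _ :=
  Topological.copy (HomZ A B) (initial_topology hom_ptws).

Lemma hom_eval_continuous (x : A) :
  continuous (fun f : HomZ A B => hom_eval f x : discrete_topology B).
Proof.
move=> f; apply: (@continuous_comp _ _ _ hom_ptws
  (@proj A (fun=> discrete_topology B) x)).
  exact: initial_continuous.
exact: proj_continuous.
Qed.

Lemma hom_sub_continuous :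
  continuous (fun f : HomZ A B * HomZ A B => f.1 - f.2).
Proof.
apply: (@continuous_comp_initial _ _ _ hom_ptws).
apply: continuous_prod_topology => x [f g] U Ufg.
exists ([set h | hom_eval h x = hom_eval f x],
        [set h | hom_eval h x = hom_eval g x]) => /=.
  split.
    exact: (@hom_eval_continuous x f [set hom_eval f x] (discrete_set1 _)).
  exact: (@hom_eval_continuous x g [set hom_eval g x] (discrete_set1 _)).
move=> [f' g'] /= [ef eg]; have := nbhs_singleton Ufg.
by rewrite /hom_ptws /hom_eval /= -/(hom_eval f' x) -/(hom_eval g' x) ef eg.
Qed.

HB.instance Definition _ :=
  PreTopologicalNmodule_isTopologicalZmodule.Build (HomZ A B)
    hom_sub_continuous.

End hom_topology.

Definition hom_comp (A B C : zmodType) (g : HomZ B C) (f : HomZ A B) :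
  HomZ A C :=
  ((g : {additive B -> C}) \o (f : {additive A -> B}) : A -> C).

Lemma hom_compE (A B C : zmodType) (g : HomZ B C) (f : HomZ A B) x :
  hom_eval (hom_comp g f) x = hom_eval g (hom_eval f x).
Proof. by []. Qed.

Definition dprod (T : nat -> zmodType) : Type := forall i, T i.

Section dprod_group.
Variable T : nat -> zmodType.
Implicit Types x y z : dprod T.

HB.instance Definition _ := gen_eqMixin (dprod T).
HB.instance Definition _ := gen_choiceMixin (dprod T).

Definition dprod0 : dprod T := fun=> 0.
Definition dprod_opp x : dprod T := fun i => - x i.
Definition dprod_add x y : dprod T := fun i => x i + y i.

Lemma dprod_addA : associative dprod_add.
Proof.
by move=> x y z; apply/functional_extensionality_dep => i; exact: addrA.
Qed.
Lemma dprod_addC : commutative dprod_add.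
Proof.
by move=> x y; apply/functional_extensionality_dep => i; exact: addrC.
Qed.
Lemma dprod_add0 : left_id dprod0 dprod_add.
Proof. by move=> x; apply/functional_extensionality_dep => i; exact: add0r. Qed.
Lemma dprod_addN : left_inverse dprod0 dprod_opp dprod_add.
Proof. by move=> x; apply/functional_extensionality_dep => i; exact: addNr. Qed.

HB.instance Definition _ :=
  GRing.isZmodule.Build (dprod T) dprod_addA dprod_addC dprod_add0 dprod_addN.

Lemma dprodBE x y i : (x - y) i = x i - y i. Proof. by []. Qed.

End dprod_group.

Section dprod_topology.
Variable T : nat -> topologicalZmodType.

HB.instance Definition _ := Topological.copy (dprod T)
  (initial_topology (id : dprod T -> prod_topology T)).

Lemma dprod_proj_continuous i : continuous (fun x : dprod T => x i).
Proof.
move=> x; apply: (@continuous_comp _ _ _ (id : dprod T -> prod_topology T)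
  (@proj nat T i)).
  exact: initial_continuous.
exact: proj_continuous.
Qed.

Lemma dprod_sub_continuous :
  continuous (fun x : dprod T * dprod T => x.1 - x.2).
Proof.
apply: (@continuous_comp_initial _ _ _ (id : dprod T -> prod_topology T)).
apply: continuous_prod_topology => i x.
apply: (@continuous_comp _ _ _
  (fun x : dprod T * dprod T => (x.1 i, x.2 i))
  (fun y : T i * T i => y.1 - y.2)); last exact: sub_continuous.
apply: cvg_pair.
  apply: (@continuous_comp _ _ _ fst (fun x : dprod T => x i)).
    exact: cvg_fst.
  exact: dprod_proj_continuous.
apply: (@continuous_comp _ _ _ snd (fun x : dprod T => x i)).
  exact: cvg_snd.
exact: dprod_proj_continuous.
Qed.

HB.instance Definition _ :=
  PreTopologicalNmodule_isTopologicalZmodule.Build (dprod T)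
    dprod_sub_continuous.

End dprod_topology.

Section direct_sum.
Variable T : nat -> zmodType.

Definition fin_supp : {pred dprod T} :=
  fun x => `[< finite_set [set i | x i != 0] >].

Lemma fin_supp_zmod_closed : zmod_closed fin_supp.
Proof.
split=> [|x y /asboolP fx /asboolP fy]; apply/asboolP.
  by apply: (sub_finite_set _ (finite_set0 nat)) => i /=; rewrite eqxx.
have fxy : finite_set ([set i | x i != 0] `|` [set i | y i != 0]).
  by rewrite finite_setU.
apply: (sub_finite_set _ fxy) => i /=; apply: contraNP => /not_orP[].
move=> /negP/negPn/eqP xi0 /negP/negPn/eqP yi0.
by rewrite dprodBE xi0 yi0 subr0.
Qed.

HB.instance Definition _ :=
  GRing.isZmodClosed.Build (dprod T) fin_supp fin_supp_zmod_closed.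

Definition dsum : zmodType := subgrp fin_supp.

Definition dsum_coef (x : dsum) : dprod T := \val x.

Lemma dsumP (x y : dsum) : (forall i, dsum_coef x i = dsum_coef y i) -> x = y.
Proof. by move=> xy; apply/val_inj/functional_extensionality_dep. Qed.

Lemma dsumB (x y : dsum) i :
  dsum_coef (x - y) i = dsum_coef x i - dsum_coef y i.
Proof. by rewrite /dsum_coef (raddfB (\val : dsum -> dprod T)). Qed.

Lemma dsum_finite (x : dsum) : finite_set [set i | dsum_coef x i != 0].
Proof. by apply/asboolP; exact: (valP x). Qed.

Lemma dsum_in_subproof i (t : T i) : dfwith (0 : dprod T) i t \in fin_supp.
Proof.
apply/asboolP; apply: (sub_finite_set _ (finite_set1 i)) => k /=.
by case: dfwithP => // l _; rewrite eqxx.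
Qed.

Definition dsum_in i (t : T i) : dsum :=
  Sub (dfwith (0 : dprod T) i t) (dsum_in_subproof t).

Lemma dsum_inE i (t : T i) k :
  dsum_coef (dsum_in t) k = dfwith (0 : dprod T) i t k.
Proof. by []. Qed.

Lemma dsum_in_is_zmod_morphism i : zmod_morphism (@dsum_in i).
Proof.
move=> s t; apply: dsumP => k; rewrite dsumB !dsum_inE.
have [<-|ik] := eqVneq i k; first by rewrite !dfwithin.
by rewrite !dfwithout// subrr.
Qed.

HB.instance Definition _ i := GRing.isZmodMorphism.Build (T i) dsum (@dsum_in i)
  (@dsum_in_is_zmod_morphism i).

Section universal_property.
Variables (B : zmodType) (u : forall i, {additive T i -> B}).

Definition dsum_case (x : dsum) : B :=
  \sum_(i \in [set: nat]) u i (dsum_coef x i).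

Lemma dsum_case_is_zmod_morphism : zmod_morphism dsum_case.
Proof.
move=> x y.
pose A := [set i | dsum_coef x i != 0] `|` [set i | dsum_coef y i != 0].
have finA : finite_set A by rewrite finite_setU; split; exact: dsum_finite.
have sumA (z : dsum) : (forall i, ~ A i -> dsum_coef z i = 0) ->
    dsum_case z = \sum_(i \in A) u i (dsum_coef z i).
  move=> zA; rewrite /dsum_case; apply/esym/fsbig_widen => // i /= [_ /zA ->].
  by rewrite raddf0.
have xA i : ~ A i -> dsum_coef x i = 0.
  by move=> /not_orP[/negP/negPn/eqP].
have yA i : ~ A i -> dsum_coef y i = 0.
  by move=> /not_orP[_ /negP/negPn/eqP].
rewrite !sumA//; last by move=> i Ai; rewrite dsumB xA// yA// subr0.
rewrite !fsbig_finite// -sumrB; apply: eq_bigr => i _.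
by rewrite dsumB raddfB.
Qed.

HB.instance Definition _ :=
  GRing.isZmodMorphism.Build dsum B dsum_case dsum_case_is_zmod_morphism.

Lemma dsum_case_in i (t : T i) : dsum_case (dsum_in t) = u i t.
Proof.
rewrite /dsum_case -(fsbig_widen [set i])//=.
  by rewrite fsbig_set1 dsum_inE dfwithin.
move=> k /= [_ ki]; rewrite dsum_inE dfwithout ?raddf0//.
by apply/eqP => ik; apply: ki.
Qed.

End universal_property.

End direct_sum.

Definition subgrps (G : zmodType) (S : nat -> zmodClosed G) (i : nat) :
  zmodType := subgrp (S i).

Section filtration.
Variables (G : zmodType) (S : nat -> zmodClosed G).
Hypothesis incS : forall i, {subset S i <= S i.+1}.
Local Notation T := (subgrps S).

Definition subgrp_incl i (x : subgrp (S i)) : subgrp (S i.+1) :=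
  Sub (\val x) (incS (valP x)).

Lemma subgrp_incl_is_zmod_morphism i : zmod_morphism (@subgrp_incl i).
Proof. 
move=> x y; apply: val_inj.
rewrite [RHS](raddfB (\val : subgrp (S i.+1) -> G)).
exact: (raddfB (\val : subgrp (S i) -> G)).
 Qed.

HB.instance Definition _ i := GRing.isZmodMorphism.Build
  (subgrp (S i)) (subgrp (S i.+1)) (@subgrp_incl i)
  (@subgrp_incl_is_zmod_morphism i).

Definition psi_fun (x : dprod T) : dprod T := fun i =>
  if i is n.+1 then x n.+1 - subgrp_incl (x n) else x 0%N.

Lemma psi_fun_fin_supp (x : dsum T) : psi_fun (dsum_coef x) \in @fin_supp T.
Proof.
apply/asboolP.
have fx : finite_set ([set i | dsum_coef x i != 0] `|`
                      (succn @` [set i | dsum_coef x i != 0])).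
  by rewrite finite_setU; split; [|apply: finite_image]; exact: dsum_finite.
apply: (sub_finite_set _ fx) => -[|n] /=; first by left.
apply: contraNP => /not_orP[/negP/negPn/eqP xS0 xn].
have /eqP xn0 : dsum_coef x n == 0.
  by apply/negPn/negP => xn0; apply: xn; exists n.
by rewrite xS0 xn0 raddf0 subrr.
Qed.

(* the endomorphism of the direct sum sending the copy of g in the i-th
   summand to its copy in the i-th minus its copy in the (i+1)-st summand *)
Definition psi (x : dsum T) : dsum T :=
  Sub (psi_fun (dsum_coef x)) (psi_fun_fin_supp x).

Lemma psiE (x : dsum T) i : dsum_coef (psi x) i = psi_fun (dsum_coef x) i.
Proof. by []. Qed.

Lemma psi_is_zmod_morphism : zmod_morphism psi.
Proof.
move=> x y; apply: dsumP => -[|n]; rewrite dsumB !psiE /psi_fun !dsumB//.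
by rewrite raddfB !opprB [RHS]addrACA [LHS]addrACA [- _ - _]addrC.
Qed.

HB.instance Definition _ :=
  GRing.isZmodMorphism.Build (dsum T) (dsum T) psi psi_is_zmod_morphism.

Lemma psi_in i (g : subgrps S i) :
  psi (dsum_in g) = dsum_in g - dsum_in (subgrp_incl g : subgrps S i.+1).
Proof.
apply: dsumP => k; rewrite dsumB psiE !dsum_inE.
case: k => [|n]; rewrite /psi_fun !dsum_inE.
  by rewrite [X in _ = _ - X]dfwithout// subr0.
congr (_ - _); have [<-|ni] := eqVneq i n; first by rewrite !dfwithin.
by rewrite !dfwithout// raddf0.
Qed.

End filtration.

Section dsum_total.
Variables (G : zmodType) (S : nat -> zmodClosed G).

Definition dsum_sum : {additive dsum (subgrps S) -> G} :=
  dsum_case (fun i => \val : {additive subgrps S i -> G}).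

End dsum_total.

Definition exact_at (A B C : zmodType) (i : A -> B) (q : B -> C) : Prop :=
  forall y, q y = 0 <-> exists x, y = i x.

Definition short_exact (A B C : zmodType) (i : A -> B) (q : B -> C) : Prop :=
  [/\ injective i, exact_at i q & forall z, exists y, z = q y].

Definition injective_group (I : zmodType) : Prop :=
  forall (A B : zmodType) (i : {additive A -> B}) (f : {additive A -> I}),
    injective i -> exists g : {additive B -> I}, forall x, g (i x) = f x.

Record inj_resolution (H : zmodType) := InjResolution {
  res0 : zmodType;
  res1 : zmodType;
  res_in : {additive H -> res0};
  res_d : {additive res0 -> res1};
  res_exact : short_exact res_in res_d;
  res0_injective : injective_group res0;
  res1_injective : injective_group res1
}.

Section ext.
Variables (G H : zmodType) (R : inj_resolution H).

Definition res_push (f : HomZ G (res0 R)) : HomZ G (res1 R) :=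
  hom_comp (res_d R) f.

Lemma res_push_is_zmod_morphism : zmod_morphism res_push.
Proof.
by move=> f g; apply: homP => x; exact: (raddfB (res_d R)).
Qed.

HB.instance Definition _ := GRing.isZmodMorphism.Build
  (HomZ G (res0 R)) (HomZ G (res1 R)) res_push res_push_is_zmod_morphism.

Definition Ext : topologicalZmodType := coker res_push.
Definition Ext_class : {additive HomZ G (res1 R) -> Ext} := coker_pi res_push.

(* c is the class of the extension 0 -> H -i-> E -q-> G -> 0: a morphism b
   from E to res0 extending res_in exists by injectivity, and c is the class of
   the map phi that b induces on the quotients G = E / H and res1 = res0 / H *)
Definition extension_class (E : zmodType) (i : {additive H -> E})
    (q : {additive E -> G}) (c : Ext) : Prop :=
  exists (b : {additive E -> res0 R}) (phi : {additive G -> res1 R}),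
    [/\ forall h, b (i h) = res_in R h,
        forall e, res_d R (b e) = phi (q e) & c = Ext_class phi].

Definition pure_mono (E : zmodType) (i : {additive H -> E}) : Prop :=
  forall n : nat, (0 < n)%N ->
    range i `&` range (fun e : E => e *+ n) = i @` range (fun h : H => h *+ n).

Definition pext_pred : {pred Ext} := fun c =>
  `[< exists (E : zmodType) (i : {additive H -> E}) (q : {additive E -> G}),
      [/\ short_exact i q, pure_mono i & extension_class i q c] >].

Definition torsion_lift (phi : {additive G -> res1 R}) : Prop :=
  forall (n : nat) (g : G), (0 < n)%N -> g *+ n = 0 ->
    exists2 x, res_d R x = phi g & x *+ n = 0.

Section pullback.
Variable phi : {additive G -> res1 R}.

Definition pullback_pred : {pred (res0 R * G)%type} :=
  fun x => res_d R x.1 == phi x.2.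

Lemma pullback_zmod_closed : zmod_closed pullback_pred.
Proof.
split=> [|x y /eqP xP /eqP yP]; apply/eqP; first by rewrite !raddf0.
by rewrite !raddfB xP yP.
Qed.

HB.instance Definition _ := GRing.isZmodClosed.Build (res0 R * G)%type
  pullback_pred pullback_zmod_closed.

Let E : zmodType := subgrp pullback_pred.

Lemma pullback_in_subproof (h : H) :
  (res_in R h, 0 : G) \in pullback_pred.
Proof.
apply/eqP; rewrite /= raddf0; have [_ ex _] := res_exact R.
by apply/ex; exists h.
Qed.

Definition pullback_in (h : H) : E :=
  Sub (res_in R h, 0 : G) (pullback_in_subproof h).

Lemma pullback_in_is_zmod_morphism : zmod_morphism pullback_in.
Proof.
move=> h k; apply: val_inj; rewrite [RHS](raddfB (\val : E -> _)).
by congr pair; rewrite /= ?raddfB ?subrr.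
Qed.

HB.instance Definition _ := GRing.isZmodMorphism.Build H E pullback_in
  pullback_in_is_zmod_morphism.

Definition pullback_q (e : E) : G := (\val e).2.

Lemma pullback_q_is_zmod_morphism : zmod_morphism pullback_q.
Proof. by move=> x y; rewrite /pullback_q (raddfB (\val : E -> _)). Qed.

HB.instance Definition _ := GRing.isZmodMorphism.Build E G pullback_q
  pullback_q_is_zmod_morphism.

Definition pullback_b (e : E) : res0 R := (\val e).1.

Lemma pullback_b_is_zmod_morphism : zmod_morphism pullback_b.
Proof. by move=> x y; rewrite /pullback_b (raddfB (\val : E -> _)). Qed.

HB.instance Definition _ := GRing.isZmodMorphism.Build E (res0 R) pullback_b
  pullback_b_is_zmod_morphism.

Lemma pullbackP (e : E) : res_d R (pullback_b e) = phi (pullback_q e).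
Proof. by apply/eqP; exact: (valP e). Qed.

Lemma pullback_eq (x y : E) :
  pullback_b x = pullback_b y -> pullback_q x = pullback_q y -> x = y.
Proof.
rewrite /pullback_b /pullback_q => xy1 xy2; apply: val_inj.
by case: (\val x) (\val y) xy1 xy2 => [? ?] [? ?] /= -> ->.
Qed.

Lemma pullback_exact : short_exact pullback_in pullback_q.
Proof.
have [inj ex surj] := res_exact R; split.
- by move=> h k /(congr1 pullback_b) /inj.
- move=> e; split=> [qe0|[h ->]//].
  have /ex[h hE] : res_d R (pullback_b e) = 0 by rewrite pullbackP qe0 raddf0.
  by exists h; apply: pullback_eq.
- move=> g; have [x xE] := surj (phi g).
  have xP : (x, g) \in pullback_pred by apply/eqP; rewrite /= xE.
  by exists (Sub (x, g) xP).
Qed.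

Lemma pullback_pure : torsion_lift phi -> pure_mono pullback_in.
Proof.
move=> lift n n0; have [inj ex _] := res_exact R.
apply/seteqP; split=> [_ [[h _ <-] [e _ eE]]|_ [_ [k _ <-] <-]].
  have bE : pullback_b e *+ n = res_in R h.
    by rewrite -(raddfMn pullback_b) eE.
  have qE : pullback_q e *+ n = 0 by rewrite -(raddfMn pullback_q) eE.
  have [x dx xn] := lift _ _ n0 qE.
  have /ex[k kE] : res_d R (pullback_b e - x) = 0.
    by rewrite raddfB pullbackP dx subrr.
  exists (k *+ n); first by exists k.
  congr pullback_in; apply: inj.
  by rewrite raddfMn -kE mulrnBl bE xn subr0.
by split; [exists (k *+ n) | exists (pullback_in k) => //; rewrite raddfMn].
Qed.

End pullback.

Lemma pext_classP (phi : {additive G -> res1 R}) :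
  torsion_lift phi -> Ext_class phi \in pext_pred.
Proof.
move=> lift; apply/asboolP; exists (subgrp (pullback_pred phi)).
exists (pullback_in phi), (@pullback_q phi); split.
- exact: pullback_exact.
- exact: pullback_pure.
- exists (@pullback_b phi), phi; split=> //; exact: pullbackP.
Qed.

Lemma pext_torsion_lift (c : Ext) : c \in pext_pred ->
  exists2 phi, torsion_lift phi & c = Ext_class phi.
Proof.
move=> /asboolP[E [i [q [[inj ex surj] pur [b [phi [bi bphi ->]]]]]]].
exists phi => // n g n0 gn0; have [e gE] := surj g.
have /ex[h hE] : q (e *+ n) = 0 by rewrite raddfMn -gE.
have [_ [k _ <-] kE] : (i @` range (fun h : H => h *+ n)) (e *+ n).
  by rewrite -pur//; split; [exists h | exists e].
exists (b (e - i k)).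
  rewrite bphi raddfB -gE (_ : q (i k) = 0) ?subr0//.
  by apply/ex; exists k.
by rewrite -raddfMn mulrnBl -(raddfMn i) kE subrr raddf0.
Qed.

Lemma pext_pred_zmod_closed : zmod_closed pext_pred.
Proof.
split=> [|c d /pext_torsion_lift[phi phiP ->] /pext_torsion_lift[psi psiP ->]].
  rewrite -(raddf0 Ext_class); apply: pext_classP => n g _ _.
  by exists 0; rewrite ?raddf0 ?mul0rn.
rewrite -raddfB; apply: pext_classP => n g n0 gn0.
have [x xE xn] := phiP n g n0 gn0; have [y yE yn] := psiP n g n0 gn0.
exists (x - y); last by rewrite mulrnBl xn yn subr0.
by rewrite raddfB xE yE.
Qed.

HB.instance Definition _ :=
  GRing.isZmodClosed.Build Ext pext_pred pext_pred_zmod_closed.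

Definition Pext : topologicalZmodType := subgrp pext_pred.

(* connecting homomorphism HomZ A H -> Ext G of 0 -> A -a-> B -q-> G -> 0,
   as a graph: extend res_in \o f along a to F : B -> res0, and pass to the
   map phi : G -> res1 that F induces on B / A = G *)
Definition connecting (A B : zmodType) (a : {additive A -> B})
    (q : {additive B -> G}) (f : HomZ A H) (c : Ext) : Prop :=
  exists (F : {additive B -> res0 R}) (phi : {additive G -> res1 R}),
    [/\ forall x, F (a x) = res_in R (hom_eval f x),
        forall y, res_d R (F y) = phi (q y) & c = Ext_class phi].

End ext.

Section lim1.
Variables (G H : zmodType) (S : nat -> zmodClosed G).
Hypothesis incS : forall i, {subset S i <= S i.+1}.

Definition prod_hom : topologicalZmodType :=
  dprod (fun i => HomZ (subgrp (S i)) H).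

Definition Psi (f : prod_hom) : prod_hom :=
  fun i => f i - hom_comp (f i.+1) (@subgrp_incl G S incS i).

Lemma Psi_is_zmod_morphism : zmod_morphism Psi.
Proof.
move=> f g; apply/functional_extensionality_dep => i; apply: homP => x.
rewrite dprodBE /Psi !homBE !hom_compE homBE !opprB.
by rewrite addrACA [RHS]addrACA [- _ - _]addrC.
Qed.

HB.instance Definition _ :=
  GRing.isZmodMorphism.Build prod_hom prod_hom Psi Psi_is_zmod_morphism.

Definition lim1_hom : topologicalZmodType := coker Psi.
Definition lim1_class : {additive prod_hom -> lim1_hom} := coker_pi Psi.

Definition hom_dsum_prod (f : HomZ (dsum (subgrps S)) H) : prod_hom :=
  fun i => hom_comp f (@dsum_in (subgrps S) i).

(* J is the inverse of the map from coker psi^* to Pext induced by the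
   connecting homomorphism of 0 -> dsum -psi-> dsum -dsum_sum-> G -> 0 *)
Definition is_jensen (R : inj_resolution H) (J : Pext G R -> lim1_hom) : Prop :=
  forall (f : HomZ (dsum (subgrps S)) H) (c : Pext G R),
    connecting (psi incS) (dsum_sum S) f (\val c) <->
    J c = lim1_class (hom_dsum_prod f).

Lemma hom_dsum_prod_surj (f : prod_hom) : exists f', f = hom_dsum_prod f'.
Proof.
pose u i : {additive subgrps S i -> H} := f i.
exists (dsum_case u : {additive dsum (subgrps S) -> H}).
apply/functional_extensionality_dep => i; apply: homP => x.
by rewrite hom_compE [RHS]dsum_case_in.
Qed.

Lemma is_jensen_unique (R : inj_resolution H) (J J' : Pext G R -> lim1_hom) :
  is_jensen J -> is_jensen J' -> J =1 J'.
Proof.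
move=> jJ jJ' c; have [f0 Jc] : exists f0, J c = lim1_class f0.
  exact: tquot_pi_surj.
have [f f0E] := hom_dsum_prod_surj f0; rewrite Jc f0E.
by apply/esym/jJ'/jJ; rewrite Jc f0E.
Qed.

End lim1.

Definition topgroup_iso (M N : topologicalZmodType) (f : M -> N) : Prop :=
  zmod_morphism f /\
  exists g : N -> M, [/\ cancel f g, cancel g f, continuous f & continuous g].

(* Main.v *)
Require Import Defs.
From HB Require Import structures.
From mathcomp Require Import all_boot all_order all_algebra finmap.
From mathcomp Require Import all_classical all_reals all_analysis.
Set Implicit Arguments.
Unset Strict Implicit.
Unset Printing Implicit Defensive.
Import Order.TTheory GRing.Theory Num.Theory.
Local Open Scope classical_set_scope.
Local Open Scope ring_scope.

(** Write [0 -> H -> I -d-> I' -> 0] for the resolution.  An element of [Pext]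
    is the class of a map [phi : G -> I'] along which torsion relations lift to
    [I].  Splitting cyclic summands off a finitely generated subgroup, and
    extending along the injective group [I], such a [phi] agrees on each [G_i]
    with [d F_i] for some [F_i : G -> I]; the differences [F_i - F_{i+1}] take
    values in [H] on [G_i] and represent the element of [lim^1] attached to
    [phi].

    Both topologies turn out to be indiscrete.  The maps [phi - d F_i] all
    represent the class of [phi] and converge pointwise to [0]; and the image of
    [Psi] is dense, since [Psi k = h] can be solved on any initial segment of
    coordinates by descending recursion.  Hence every map between the two groups
    is continuous and only the algebraic statement is left. *)

(** * Additive maps and extension into injective groups *)

Lemma subrACA (A : zmodType) (a b c d : A) : a - b - (c - d) = a - c - (b - d).
Proof. by rewrite opprD addrACA -opprD. Qed.

Lemma zmod_morphism_additive (A B : zmodType) (f : A -> B) :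
  zmod_morphism f -> exists g : {additive A -> B}, g =1 f.
Proof.
move=> fP; pose m := GRing.isZmodMorphism.Build A B f fP.
by exists (HB.pack_for {additive A -> B} f m).
Qed.

Lemma zmod_closed_zmodClosed (G : zmodType) (P : {pred G}) :
  zmod_closed P -> exists S : zmodClosed G, S =i P.
Proof.
move=> PP; pose m := GRing.isZmodClosed.Build G P PP.
by exists (HB.pack_for (zmodClosed G) P m).
Qed.

Lemma injective_group_extend (I G : zmodType) (S : zmodClosed G)
    (f : {additive subgrp S -> I}) :
  injective_group I -> exists g : {additive G -> I}, forall x, g (\val x) = f x.
Proof.
move=> injI.
by apply: (injI _ _ (\val : {additive subgrp S -> G})); exact: val_inj.
Qed.

(** On the subgroup of all [b + s *~ n] with [b] in [B], put [b + s *~ n |-> y *~ n]. Two choices of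
    [n] for one element differ by an integer that takes [s] into [B], hence kills [y]; so this is
    well defined, and injectivity of [I] extends it to [G]. *)
Lemma injective_group_extend_cyclic (I G : zmodType) (B : zmodClosed G)
    (s : G) (y : I) :
  injective_group I -> (forall n : int, s *~ n \in B -> y *~ n = 0) ->
  exists2 g : {additive G -> I}, {in B, forall x, g x = 0} & g s = y.
Proof.
move=> injI sy.
pose P : {pred G} := fun x => `[< exists n : int, x - s *~ n \in B >].
have PP : zmod_closed P.
  split=> [|x z /asboolP[n xn] /asboolP[k zk]]; apply/asboolP.
    by exists 0; rewrite subr0 rpred0.
  by exists (n - k); rewrite mulrzBr subrACA rpredB.
have [A AE] := zmod_closed_zmodClosed PP.
have AP (x : subgrp A) : exists n : int, \val x - s *~ n \in B.
  by have := valP x; rewrite AE => /asboolP.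
have [c cP] := boolp.choice AP.
have cE (x : subgrp A) n : \val x - s *~ n \in B -> y *~ c x = y *~ n.
  move=> xn; apply/eqP; rewrite -subr_eq0 -mulrzBr sy//.
  have := rpredB xn (cP x).
  by rewrite subrACA subrr sub0r opprB -mulrzBr.
have [f fE] : exists f : {additive subgrp A -> I}, f =1 (fun x => y *~ c x).
  apply: zmod_morphism_additive => x z; rewrite /= -mulrzBr; apply: cE.
  rewrite (raddfB (\val : subgrp A -> G)) mulrzBr subrACA.
  exact: (rpredB (cP x) (cP z)).
have [g gE] := injective_group_extend f injI.
exists g => [x xB|].
  have xA : x \in A by rewrite AE; apply/asboolP; exists 0; rewrite subr0.
  by rewrite -[x]/(\val (Sub x xA : subgrp A)) gE fE (@cE _ 0)// subr0.
have sA : s \in A.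
  by rewrite AE; apply/asboolP; exists 1; rewrite mulr1z subrr rpred0.
rewrite -[s in LHS]/(\val (Sub s sA : subgrp A)) gE fE (@cE _ 1) ?mulr1z//=.
by rewrite subrr rpred0.
Qed.

(** * Lifting on finitely many elements *)

Lemma bigD1_lift (A : zmodType) (m : nat) (j : 'I_m.+1) (F : 'I_m.+1 -> A) :
  \sum_i F i = F j + \sum_k F (lift j k).
Proof. by rewrite (bigD1_ord j). Qed.

Section torsion_lift_finite.
Variables (G H : zmodType) (R : inj_resolution H).
Implicit Types phi : {additive G -> res1 R}.

Lemma lift_agree_zmodClosed phi (F : {additive G -> res0 R}) :
  exists S : zmodClosed G, forall x, x \in S <-> res_d R (F x) = phi x.
Proof.
have PP : zmod_closed (fun x => res_d R (F x) == phi x : bool).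
  split=> [|x y /eqP xP /eqP yP]; apply/eqP; first by rewrite !raddf0.
  by rewrite !raddfB xP yP.
have [S SE] := zmod_closed_zmodClosed PP.
by exists S => x; rewrite SE; split=> [/eqP|xP]; [|apply/eqP].
Qed.

Lemma torsion_liftB phi (F : {additive G -> res0 R}) :
  torsion_lift phi ->
  exists2 phi' : {additive G -> res1 R}, torsion_lift phi' &
    forall x, phi' x = phi x - res_d R (F x).
Proof.
move=> phiT.
have [phi' phi'E] : exists phi' : {additive G -> res1 R},
    phi' =1 (fun x => phi x - res_d R (F x)).
  apply: zmod_morphism_additive => x y /=.
  by rewrite (raddfB phi) (raddfB F) (raddfB (res_d R)) subrACA.
exists phi' => // n g n0 gn0; have [x dx xn] := phiT _ _ n0 gn0.
exists (x - F g); first by rewrite raddfB dx phi'E.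
by rewrite mulrnBl xn -raddfMn gn0 raddf0 subrr.
Qed.

(** The second hypothesis says that the cyclic group of [t j] meets the span [B] of the other
    members only in 0. A solution [F0] for the others can therefore be corrected at [t j] by a map
    that vanishes on [B]. *)
Lemma torsion_lift_independent (m : nat) (t : 'I_m.+1 -> G) (j : 'I_m.+1) phi :
  torsion_lift phi ->
  (forall (n : int) (b : 'I_m -> int),
    t j *~ n = \sum_k t (lift j k) *~ b k -> t j *~ n = 0) ->
  (exists F : {additive G -> res0 R},
    forall k, res_d R (F (t (lift j k))) = phi (t (lift j k))) ->
  exists F : {additive G -> res0 R}, forall i, res_d R (F (t i)) = phi (t i).
Proof.
move=> phiT indep [F0 F0E].
have [theta thlift thE] := torsion_liftB F0 phiT.
have [B BE] : exists B : zmodClosed G, B =i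
    (fun x => `[< exists b : 'I_m -> int, x = \sum_k t (lift j k) *~ b k >]).
  apply: zmod_closed_zmodClosed; split=> [|x y /asboolP[b ->] /asboolP[c ->]];
    apply/asboolP.
    by exists (fun=> 0); rewrite big1// => k _; rewrite mulr0z.
  exists (fun k => b k - c k); rewrite -sumrB.
  by apply: eq_bigr => k _; rewrite mulrzBr.
(* If [t j] has infinite order, any lift of [theta (t j)] will do. Otherwise torsion lifting at the
   order [d] of [t j] gives a lift killed by [d], and every integer that kills [t j] is a multiple
   of [d]. *)
have [y dy yn] : exists2 y, res_d R y = theta (t j) &
    forall n : int, t j *~ n = 0 -> y *~ n = 0.
  have [[n n0 tn]|tors] :=
      pselect (exists2 n : nat, (0 < n)%N & t j *+ n = 0); last first.
    have [_ _ surj] := res_exact R; have [y dy] := surj (theta (t j)).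
    exists y => // -[[|n]|n]; first by rewrite mulr0z.
      by move=> tn; exfalso; apply: tors; exists n.+1.
    rewrite NegzE mulrNz => /eqP; rewrite oppr_eq0 => /eqP tn.
    by exfalso; apply: tors; exists n.+1.
  have exn : exists n, (0 < n)%N && (t j *+ n == 0).
    by exists n; rewrite n0 tn eqxx.
  case: (ex_minnP exn) => d /andP[d0 /eqP td] dmin.
  have [y dy yd] := thlift _ _ d0 td.
  exists y => // c tc.
  have cE := divz_eq c d; have rd : (c %% d)%Z = `|(c %% d)%Z|%N.
    by rewrite gez0_abs// modz_ge0// eqz_nat -lt0n.
  have tr : t j *~ (c %% d)%Z = 0.
    by move: tc; rewrite {1}cE mulrzDr mulrC mulrzA -pmulrn td mul0rz add0r.
  have r0 : (c %% d)%Z = 0.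
    apply/eqP/negPn/negP => r0.
    have : (d <= `|(c %% d)%Z|)%N.
      by apply: dmin; rewrite absz_gt0 r0 pmulrn -rd tr eqxx.
    by rewrite leqNgt -ltz_nat -rd ltz_pmod// ltz_nat.
  by rewrite cE r0 addr0 mulrC mulrzA -pmulrn yd mul0rz.
have [|F1 F1B F1t] := @injective_group_extend_cyclic _ _ B (t j) y
    (@res0_injective _ R).
  by move=> n; rewrite BE => /asboolP[b tb]; apply: yn; exact: indep tb.
have [F FE] : exists F : {additive G -> res0 R}, F =1 (fun x => F0 x + F1 x).
  by apply: zmod_morphism_additive => a b /=; rewrite !raddfB opprD addrACA.
exists F => i; rewrite FE; case: (unliftP j i) => [k ->|->].
  rewrite F1B ?addr0 ?F0E// BE; apply/asboolP; exists (fun l => (l == k)%:Z).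
  rewrite (bigD1 k)//= eqxx mulr1z big1 ?addr0// => l /negPf ->.
  by rewrite mulr0z.
by rewrite raddfD F1t dy thE addrC subrK.
Qed.

(* Among all families of the same size spanning s, one having a relation with
   the smallest possible nonzero coefficient splits off a cyclic summand. *)
Lemma torsion_lift_finite (m : nat) (s : 'I_m -> G) phi :
  torsion_lift phi ->
  exists F : {additive G -> res0 R}, forall i, res_d R (F (s i)) = phi (s i).
Proof.
elim: m s phi => [|m IHm] s phi phiT.
  by exists (\0 : {additive G -> res0 R}) => -[].
(* Spanning is phrased through subgroups because it is applied to the subgroup on which
   [res_d R \o F] agrees with [phi]. *)
pose spans (t : 'I_m.+1 -> G) := forall S : zmodClosed G,
  (forall k, t k \in S) -> forall i, s i \in S.
(* [Q n]: the positive number [n] occurs as a coefficient in a relation of some spanning family. *)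
pose Q (n : nat) := (0 < n)%N /\ exists t, spans t /\
  exists (a : 'I_m.+1 -> int) j, a j = n /\ \sum_i t i *~ a i = 0.
have QI t (a : 'I_m.+1 -> int) j : spans t -> \sum_i t i *~ a i = 0 ->
    a j != 0 -> Q `|a j|%N.
  move=> st ta0 aj0; split; first by rewrite absz_gt0.
  exists t; split=> //; have [aj|aj] := leP 0 (a j).
    by exists a, j; rewrite gez0_abs.
  exists (fun i => - a i), j; rewrite ltz0_abs//; split=> //.
  under eq_bigr do rewrite mulrNz.
  by rewrite sumrN ta0 oppr0.
have relation (t : 'I_m.+1 -> G) j n (b : 'I_m -> int) :
    t j *~ n = \sum_k t (lift j k) *~ b k ->
    exists2 a : 'I_m.+1 -> int, a j = n & \sum_i t i *~ a i = 0.
  move=> tn; exists (fun i => if unlift j i is Some k then - b k else n).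
    by rewrite unlift_none.
  rewrite (bigD1_lift j) unlift_none tn -big_split/= big1// => k _.
  by rewrite liftK mulrNz subrr.
(* A spanning family with one independent member suffices: the induction hypothesis treats the other
   [m] members. *)
suff [t [st [j indep]]] : exists t, spans t /\ exists j,
    forall (n : int) (b : 'I_m -> int),
      t j *~ n = \sum_k t (lift j k) *~ b k -> t j *~ n = 0.
  have [F FE] := torsion_lift_independent phiT indep (IHm (t \o lift j) _ phiT).
  have [S SE] := lift_agree_zmodClosed phi F.
  by exists F => i; apply/SE/st => k; exact/SE.
(* With no [Q n], all relations of [s] are trivial, so its member at [ord0] is independent. *)
have [[n Qn]|noQ] := pselect (exists n, Q n); last first.
  exists s; split=> //; exists ord0 => n b /relation[a aj ta].
  have [->|n0] := eqVneq n 0; first by rewrite mulr0z.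
  by case: noQ; exists `|a ord0|%N; apply: (QI s) => //; rewrite aj.
have exQ : exists n, `[< Q n >] by exists n; apply/asboolP.
case: (ex_minnP exQ) => d /asboolP[d0 [t [st [a [j [aj ta]]]]]] dmin.
have dZ0 : d%:Z != 0 by rewrite eqz_nat -lt0n.
(* A remainder modulo [d] is smaller than the minimal coefficient [d], so it can occur in a relation
   of a spanning family only as 0. *)
have Qmod t' (c : 'I_m.+1 -> int) i e : spans t' ->
    \sum_k t' k *~ c k = 0 -> c i = (e %% d)%Z -> c i = 0.
  move=> st' tc ce; apply/eqP/negPn/negP => /(QI _ _ _ st' tc)/asboolP/dmin.
  by rewrite leqNgt -ltz_nat gez0_abs ce ?modz_ge0// ltz_pmod// ltz_nat.
(* Division of the relation by [d]: since [a j = d], the quotient at [j] is 1, so [t] is recovered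
   from [t'] and [t'] still spans. The relation becomes [t' j *~ d] plus the other members times the
   remainders of the [a k]. By minimality these remainders vanish, so [d] kills [t' j]. *)
pose t' k := if k == j then \sum_i t i *~ (a i %/ d)%Z else t k.
have t'j : t' j = \sum_i t i *~ (a i %/ d)%Z by rewrite /t' eqxx.
have t'l k : t' (lift j k) = t (lift j k).
  by rewrite /t' eq_sym (negPf (neq_lift j k)).
have ajd : (a j %/ d)%Z = 1 by rewrite aj divzz dZ0.
have st' : spans t'.
  move=> S t'S; apply: st => k; case: (unliftP j k) => [l ->|->].
    by rewrite -t'l.
  have : t' j - \sum_k t' (lift j k) *~ (a (lift j k) %/ d)%Z \in S.
    by rewrite rpredB// rpred_sum// => l _; rewrite rpredMz.
  rewrite t'j (bigD1_lift j) ajd mulr1z.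
  by under [X in _ - X]eq_bigr do rewrite t'l; rewrite addrK.
pose r k := if k == j then d%:Z else (a k %% d)%Z.
have t'r : \sum_k t' k *~ r k = 0.
  rewrite (bigD1_lift j) t'j /r eqxx -[RHS]ta [in RHS](bigD1_lift j).
  rewrite (bigD1_lift j) ajd mulr1z aj mulrzDl -addrA; congr (_ + _).
  rewrite mulrz_suml -big_split/=; apply: eq_bigr => k _.
  rewrite eq_sym (negPf (neq_lift j k)) t'l -mulrzA -mulrzDr.
  by rewrite -divz_eq.
have t'd : t' j *~ d = 0.
  move: (t'r); rewrite (bigD1_lift j) big1 ?addr0; first by rewrite /r eqxx.
  move=> k _; rewrite (@Qmod t' r _ (a (lift j k)))// ?mulr0z//.
  by rewrite /r eq_sym (negPf (neq_lift j k)).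
(* As [d] kills [t' j], the coefficient [c] may be replaced by its remainder modulo [d], which
   [Qmod] makes 0. *)
exists t'; split=> //; exists j => c b tc.
have tr : t' j *~ (c %% d)%Z = \sum_k t' (lift j k) *~ b k.
  rewrite -tc [in RHS](divz_eq c d) [RHS]mulrzDr [_ * _]mulrC mulrzA.
  by rewrite t'd mul0rz add0r.
have [e ej te] := relation _ _ _ _ tr.
have := @Qmod t' e j c st' te ej; rewrite ej => c0.
by rewrite (divz_eq c d) c0 addr0 mulrC mulrzA t'd mul0rz.
Qed.

End torsion_lift_finite.

(** * Pointwise convergence and neighbourhoods in cokernels *)

Lemma cvg_initial_topology (X : choiceType) (Y : topologicalType) (h : X -> Y)
    (F : set_system X) (x : initial_topology h) :
  Filter F -> h @ F --> h x -> F --> x.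
Proof.
move=> FF hF U [V] [[W oW <-] Wx WU]; apply: (filterS WU).
by apply: (hF W); apply: open_nbhs_nbhs; split.
Qed.

Lemma cvg_prod_topology (I : Type) (T : I -> topologicalType)
    (F : set_system (prod_topology T)) (x : prod_topology T) :
  Filter F -> (forall i, @proj I T i @ F --> x i) -> F --> x.
Proof.
move=> FF xF; apply/cvg_sup => i U [V] [[W oW <-] Wx WU].
apply: (filterS WU); apply: (xF i W).
by apply: open_nbhs_nbhs; split.
Qed.

Lemma cvg_hom (A B : zmodType) (u : nat -> HomZ A B) (f : HomZ A B) :
  (forall x, \forall n \near \oo, hom_eval (u n) x = hom_eval f x) ->
  u @ \oo --> f.
Proof.
move=> uf; apply: cvg_initial_topology; apply: cvg_prod_topology => x.
by apply: cvg_near_cst; exact: uf.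
Qed.

Lemma cvg_dprod (T : nat -> topologicalZmodType) (u : nat -> dprod T)
    (f : dprod T) :
  (forall i, \forall n \near \oo, u n i = f i) -> u @ \oo --> f.
Proof.
move=> uf; apply: cvg_initial_topology; apply: cvg_prod_topology => i.
by apply: cvg_near_cst; exact: uf.
Qed.

(** The preimage of [U] under the continuous projection is a neighbourhood of [x], hence contains
    some [v n], and the class of [v n] is that of [y]. This is how both topologies are shown to be
    indiscrete. *)
Lemma coker_nbhs_limit (M : zmodType) (N : topologicalZmodType)
    (u : {additive M -> N}) (v : nat -> N) (x y : N) (U : set (coker u)) :
  v @ \oo --> x -> (forall n, coker_pi u (v n) = coker_pi u y) ->
  nbhs (coker_pi u x) U -> U (coker_pi u y).
Proof.
move=> vx vy /(@tquot_pi_continuous _ (im_pred u)) /vx [n _ /(_ n (leqnn n))].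
by rewrite -(vy n).
Qed.

Lemma coker_piP (M : zmodType) (N : topologicalZmodType)
    (u : {additive M -> N}) (x y : N) :
  coker_pi u x = coker_pi u y <-> exists z, x - y = u z.
Proof.
split=> [/(@tquot_piP _ (im_pred u))/asboolP//|xy].
by apply/(@tquot_piP _ (im_pred u))/asboolP.
Qed.

(** * Maps out of direct sums and increasing unions *)

Lemma dsum_additive_ext (T : nat -> zmodType) (B : zmodType)
    (g h : {additive dsum T -> B}) :
  (forall i (t : T i), g (dsum_in t) = h (dsum_in t)) -> g =1 h.
Proof.
move=> gh x; have fx := dsum_finite x.
(* Each element is the finite sum of its components over its support; this is checked through the
   coordinate projections [p]. *)
suff -> : x = \sum_(i <- fset_set [set i | dsum_coef x i != 0])
                 dsum_in (dsum_coef x i).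
  by rewrite !raddf_sum; apply: eq_bigr => i _; exact: gh.
apply: dsumP => k.
have [p pE] : exists p : {additive dsum T -> T k},
    p =1 (fun y => dsum_coef y k).
  by apply: zmod_morphism_additive => a b /=; rewrite dsumB.
rewrite -[RHS]pE raddf_sum.
have pin i : i != k -> p (dsum_in (dsum_coef x i)) = 0.
  by move=> ik; rewrite pE dsum_inE dfwithout.
have [xk|xk] := boolP (k \in fset_set [set i | dsum_coef x i != 0]).
  rewrite (bigD1_seq k) ?fset_uniq//= big1 ?addr0; last by move=> i; exact: pin.
  by rewrite pE dsum_inE dfwithin.
have xk0 : dsum_coef x k = 0.
  apply/eqP/negPn/negP => xk0; move/negP: xk; apply.
  by rewrite in_fset_set// inE.
rewrite big1_seq// => i /andP[_ ix]; apply: pin.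
by apply: contraNneq xk => <-.
Qed.

Section union.
Variables (G : zmodType) (S : nat -> zmodClosed G).
Hypothesis incS : forall i, {subset S i <= S i.+1}.
Hypothesis unionS : forall x : G, exists i, x \in S i.

Lemma filtration_subset i j : (i <= j)%N -> {subset S i <= S j}.
Proof.
elim: j => [|j IHj]; first by rewrite leqn0 => /eqP ->.
rewrite leq_eqVlt => /predU1P[->//|ij] x xi.
by apply: incS; apply: IHj xi.
Qed.

(** Each [g] is evaluated at a chosen stage. Compatibility along successive inclusions makes the
    value independent of the stage, so additivity can be checked at a common one. *)
Lemma union_glue (M : zmodType) (u : forall i, {additive subgrp (S i) -> M}) :
  (forall i x, u i.+1 (subgrp_incl incS x) = u i x) ->
  exists v : {additive G -> M}, forall i (x : subgrp (S i)), v (\val x) = u i x.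
Proof.
move=> uS.
have ule j i (x : subgrp (S i)) (y : subgrp (S j)) : (i <= j)%N ->
    \val x = \val y -> u i x = u j y.
  elim: j y => [|j IHj] y.
    rewrite leqn0 => /eqP i0; subst i => xy; congr (u _ _); exact: val_inj.
  rewrite leq_eqVlt => /predU1P[ij|ij] xy.
    by subst i; congr (u _ _); exact: val_inj.
  pose z : subgrp (S j) := Sub (\val x) (filtration_subset (ltnSE ij) (valP x)).
  rewrite (IHj z)//= -uS; congr (u _ _); exact: val_inj.
have uE i j (x : subgrp (S i)) (y : subgrp (S j)) :
    \val x = \val y -> u i x = u j y.
  move=> xy; have [ij|/ltnW ji] := leqP i j; first exact: ule.
  by apply/esym; apply: ule.
have inS g : exists p : {i & subgrp (S i)}, \val (projT2 p) = g.
  by have [i gi] := unionS g; exists (existT _ i (Sub g gi : subgrp (S i))).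
have [p pE] := boolp.choice inS.
have [v vE] : exists v : {additive G -> M},
    v =1 (fun g => u (projT1 (p g)) (projT2 (p g))).
  apply: zmod_morphism_additive => g h /=.
  pose k := maxn (projT1 (p g)) (projT1 (p h)).
  have gk : g \in S k.
    by rewrite -(pE g); apply: filtration_subset (leq_maxl _ _) _ (valP _).
  have hk : h \in S k.
    by rewrite -(pE h); apply: filtration_subset (leq_maxr _ _) _ (valP _).
  rewrite (uE _ k (projT2 (p g)) (Sub g gk)) ?pE//.
  rewrite (uE _ k (projT2 (p h)) (Sub h hk)) ?pE//.
  rewrite -raddfB; apply: uE; rewrite pE.
  by rewrite (raddfB (\val : subgrp (S k) -> G)).
by exists v => i x; rewrite vE; apply: uE; rewrite pE.
Qed.

Lemma dsum_sum_in i (t : subgrp (S i)) :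
  dsum_sum S (dsum_in (t : subgrps S i)) = \val t.
Proof. exact: dsum_case_in. Qed.

Lemma dsum_sum_psi (x : dsum (subgrps S)) : dsum_sum S (psi incS x) = 0.
Proof.
apply: (@dsum_additive_ext _ _
  (dsum_sum S \o psi incS : {additive dsum (subgrps S) -> G})
  (\0 : {additive dsum (subgrps S) -> G})) => i t /=.
by rewrite psi_in raddfB !dsum_sum_in subrr.
Qed.

End union.

(** * Lifting and solving at finite stages *)

Lemma torsion_lift_fin_gen (G H : zmodType) (R : inj_resolution H)
    (phi : {additive G -> res1 R}) (S : zmodClosed G) :
  torsion_lift phi -> fin_gen S ->
  exists F : {additive G -> res0 R}, {in S, forall x, res_d R (F x) = phi x}.
Proof.
move=> phiT [m [s sE]].
have [F FE] := torsion_lift_finite (fun k : 'I_m => s`_k) phiT.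
exists F => x /sE[a ->]; rewrite !raddf_sum; apply: eq_bigr => k _.
by rewrite !raddfMz FE.
Qed.

(** Given a solution [k] for the shifted filtration, the coordinate 0 is forced to be [h 0] plus the
    restriction of the next coordinate, which is [k 0]. The induction varies [S] because of the
    shift. *)
Lemma Psi_solve (G H : zmodType) (n : nat) (S : nat -> zmodClosed G)
    (incS : forall i, {subset S i <= S i.+1}) (h : prod_hom H S) :
  exists k : prod_hom H S, forall i, (i < n)%N -> Psi incS k i = h i.
Proof.
elim: n S incS h => [|n IHn] S incS h; first by exists 0.
have [k kE] := IHn (S \o succn) (fun i => incS i.+1) (fun i => h i.+1).
exists (fun i => if i is j.+1 then k j
  else h 0%N + hom_comp (k 0%N) (@subgrp_incl G S incS 0)).
case=> [_|i ni]; first by rewrite /Psi /=; exact: addrK.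
by rewrite -(kE i ni); apply: homP.
Qed.

Lemma res_in_lift (A H : zmodType) (R : inj_resolution H)
    (u : {additive A -> res0 R}) :
  (forall x, res_d R (u x) = 0) ->
  exists v : {additive A -> H}, forall x, res_in R (v x) = u x.
Proof.
have [inj ex _] := res_exact R => du0.
have [v vE] := boolp.choice (fun x => (ex (u x)).1 (du0 x)).
have [w wE] : exists w : {additive A -> H}, w =1 v.
  apply: zmod_morphism_additive => x y /=; apply: inj.
  by rewrite raddfB -!vE raddfB.
by exists w => x; rewrite wE -vE.
Qed.

(** * The connecting homomorphism of the canonical sequence *)

Section jensen.
Variables (G H : zmodType) (S : nat -> zmodClosed G) (R : inj_resolution H).
Hypothesis incS : forall i, {subset S i <= S i.+1}.
Hypothesis unionS : forall x : G, exists i, x \in S i.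
Local Notation D := (dsum (subgrps S)).
Local Notation connect := (connecting (R := R) (psi incS) (dsum_sum S)).
Implicit Types (f : HomZ D H) (phi : {additive G -> res1 R}).

Lemma Ext_class0P phi :
  Ext_class G R phi = 0 <->
  exists v : {additive G -> res0 R}, forall x, phi x = res_d R (v x).
Proof.
rewrite -(raddf0 (Ext_class G R)); split=> [/coker_piP[v]|[v phiE]].
  by rewrite subr0 => phiE; exists v => x; rewrite phiE.
by apply/coker_piP; exists v; rewrite subr0; apply: homP => x; exact: phiE.
Qed.

(** The maps [F i] are the components of a single map on the direct sum. By [psi_in], its composite
    with [psi] has the components [F i - F i.+1] on [S i]. *)
Lemma connecting_intro f phi (F : nat -> {additive G -> res0 R}) :
  (forall i (x : subgrp (S i)), res_d R (F i (\val x)) = phi (\val x)) ->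
  (forall i (x : subgrp (S i)), F i (\val x) - F i.+1 (\val x) =
     res_in R (hom_eval f (dsum_in (x : subgrps S i)))) ->
  connect f (Ext_class G R phi).
Proof.
move=> dF Ff.
pose FD : {additive D -> res0 R} := dsum_case
  (fun i => F i \o (\val : subgrps S i -> G)
    : {additive subgrps S i -> res0 R}).
have FDin i (x : subgrp (S i)) : FD (dsum_in (x : subgrps S i)) = F i (\val x).
  exact: dsum_case_in.
exists FD, phi; split=> // x.
  apply: (@dsum_additive_ext _ _ (FD \o psi incS : {additive D -> res0 R})
    (res_in R \o (f : {additive D -> H}) : {additive D -> res0 R})) => i t /=.
  by rewrite psi_in raddfB !FDin Ff.
apply: (@dsum_additive_ext _ _ (res_d R \o FD : {additive D -> res1 R})
  (phi \o dsum_sum S : {additive D -> res1 R})) => i t /=.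
by rewrite FDin dF dsum_sum_in.
Qed.

(** Start with [F 0 = 0] and let [F i.+1] extend the difference of [F i] and [f] from [S i] to [G].
    Since [f] takes values in [H], the maps [res_d R \o F i] agree on successive stages and glue to
    [phi]. *)
Lemma connecting_ex f : exists c : Pext G R, connect f (\val c).
Proof.
have ext (p : nat * {additive G -> res0 R}) :
    exists F' : {additive G -> res0 R}, forall x : subgrp (S p.1),
    F' (\val x) = p.2 (\val x) -
      res_in R (hom_eval f (dsum_in (x : subgrps S p.1))).
  have [u uE] : exists u : {additive subgrp (S p.1) -> res0 R},
      u =1 (fun x => p.2 (\val x) -
        res_in R (hom_eval f (dsum_in (x : subgrps S p.1)))).
    apply: zmod_morphism_additive => x y /=.
    rewrite (raddfB p.2) (raddfB (@dsum_in (subgrps S) p.1)).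
    by rewrite /hom_eval (raddfB (f : {additive D -> H})) raddfB subrACA.
  have [F' F'E] := injective_group_extend u (@res0_injective _ R).
  by exists F' => x; rewrite F'E uE.
have [step stepE] := boolp.choice ext.
pose F := nat_rect (fun=> {additive G -> res0 R}) \0 (fun i Fi => step (i, Fi)).
have FS i (x : subgrp (S i)) : F i (\val x) - F i.+1 (\val x) =
    res_in R (hom_eval f (dsum_in (x : subgrps S i))).
  by rewrite [F i.+1 _](stepE (i, F i) x) subKr.
have [_ ex _] := res_exact R.
have [|phi phiE] := @union_glue _ _ incS unionS _
    (fun i => res_d R \o (F i \o (\val : subgrp (S i) -> G))
      : {additive subgrp (S i) -> res1 R}).
  move=> i x /=; apply/esym/eqP; rewrite -subr_eq0 -raddfB FS.
  by apply/eqP/ex; eexists.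
(* The class is pure: for torsion [g] in [S i], the lift [F i g] of [phi g] is killed by whatever
   kills [g]. *)
have Cphi : Ext_class G R phi \in @pext_pred G H R.
  apply: pext_classP => n g n0 gn0; have [i gi] := unionS g.
  exists (F i g); first by rewrite (phiE i (Sub g gi)).
  by rewrite -raddfMn gn0 raddf0.
exists (Sub (Ext_class G R phi) Cphi).
by apply: connecting_intro FS => i x; rewrite phiE.
Qed.

Lemma pext_connecting (S_fin_gen : forall i, fin_gen (S i)) (c : Pext G R) :
  exists f, connect f (\val c).
Proof.
have [phi phiT cE] := pext_torsion_lift (valP c).
have [F FE] := boolp.choice (fun i => torsion_lift_fin_gen phiT (S_fin_gen i)).
have sub i : exists u : {additive subgrps S i -> H},
    forall x, res_in R (u x) = F i (\val x) - F i.+1 (\val x).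
  have [v vE] : exists v : {additive subgrps S i -> res0 R},
      v =1 (fun x => F i (\val x) - F i.+1 (\val x)).
    apply: zmod_morphism_additive => x y /=.
    by rewrite (raddfB (F i)) (raddfB (F i.+1)) subrACA.
  have [|u uE] := @res_in_lift _ _ _ v; last by exists u => x; rewrite uE vE.
  move=> x; rewrite vE raddfB !FE ?subrr ?(valP x)//.
  exact: incS (valP x).
pose u i := projT1 (cid (sub i)); have uE i := projT2 (cid (sub i)).
exists (dsum_case u : {additive D -> H}).
rewrite cE; apply: (@connecting_intro _ _ F) => [i x|i x].
  by rewrite FE// (valP x).
by rewrite -uE; congr (res_in R _); apply/esym; exact: dsum_case_in.
Qed.

Lemma connectingB f f' c c' :
  connect f c -> connect f' c' -> connect (f - f') (c - c').
Proof.
move=> [F [phi [FE dF ->]]] [F' [phi' [F'E dF' ->]]].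
exists ((F : HomZ D (res0 R)) - (F' : HomZ D (res0 R))).
exists ((phi : HomZ G (res1 R)) - (phi' : HomZ G (res1 R))); split.
- move=> x; rewrite [LHS]homBE homBE raddfB.
  by congr (_ - _); [exact: FE | exact: F'E].
- move=> y; rewrite [X in res_d R X]homBE [RHS]homBE raddfB.
  by congr (_ - _); [exact: dF | exact: dF'].
- by rewrite -raddfB.
Qed.

Lemma hom_dsum_prodB f f' :
  hom_dsum_prod (f - f') = hom_dsum_prod f - hom_dsum_prod f'.
Proof. by apply/functional_extensionality_dep => i; apply: homP. Qed.

(** [Psi] corresponds to precomposition with [psi] when families are read as maps on the direct sum;
    both directions compare on generators by [psi_in]. *)
Lemma lim1_class0P f :
  lim1_class H incS (hom_dsum_prod f) = 0 <->
  exists g : {additive D -> H}, forall x, hom_eval f x = g (psi incS x).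
Proof.
rewrite -(raddf0 (lim1_class H incS)); split=> [/coker_piP[g0]|[g fE]].
  have [g ->] := hom_dsum_prod_surj g0; rewrite subr0 => fE.
  exists g => x.
  apply: (@dsum_additive_ext _ _ (f : {additive D -> H})
    ((g : {additive D -> H}) \o psi incS : {additive D -> H})) => i t /=.
  rewrite psi_in raddfB.
  by have /(congr1 (fun h : prod_hom H S => hom_eval (h i) t)) := fE.
apply/coker_piP; exists (hom_dsum_prod (g : HomZ D H)); rewrite subr0.
apply/functional_extensionality_dep => i; apply: homP => t.
rewrite hom_compE fE /Psi homBE !hom_compE.
by rewrite [hom_eval _ t]/(dsum_in t) psi_in raddfB.
Qed.

(** If [phi] is [res_d R \o v], then [F] minus [v \o dsum_sum S] takes values in [H] and still
    extends [f] along [psi], as [dsum_sum S] kills the image of [psi]. Conversely, an extension [g]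
    of [f] allows [F = res_in R \o g] and [phi = 0]. *)
Lemma connecting0P f :
  connect f 0 <-> lim1_class H incS (hom_dsum_prod f) = 0.
Proof.
have [inj ex _] := res_exact R.
rewrite lim1_class0P; split=> [[F [phi [FE dF]]]|[g fE]].
  move=> /esym/Ext_class0P[v vE].
  have [w wE] : exists w : {additive D -> res0 R},
      w =1 (fun y => F y - v (dsum_sum S y)).
    apply: zmod_morphism_additive => x y /=.
    by rewrite (raddfB F) (raddfB (dsum_sum S)) (raddfB v) subrACA.
  have [|g gE] := @res_in_lift _ _ _ w.
    by move=> y; rewrite wE raddfB dF vE subrr.
  exists g => x; apply: inj.
  by rewrite gE wE FE dsum_sum_psi raddf0 subr0.
exists (res_in R \o g : {additive D -> res0 R}).
exists (\0 : {additive G -> res1 R}); split.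
- by move=> x /=; rewrite fE.
- by move=> y /=; apply/ex; exists (g y).
- apply/esym/Ext_class0P; exists (\0 : {additive G -> res0 R}) => x /=.
  by rewrite raddf0.
Qed.

(** This makes the connecting relation single-valued. Here [F] vanishes on the image of [psi], so
    its components are compatible and glue to a map on [G] that lifts [phi]. *)
Lemma connecting_0l c : connect 0 c -> c = 0.
Proof.
move=> [F [phi [FE dF ->]]]; apply/Ext_class0P.
have [|v vE] := @union_glue _ _ incS unionS _
  (fun i => F \o @dsum_in (subgrps S) i : {additive subgrps S i -> res0 R}).
  move=> i x /=; apply/esym/eqP; rewrite -subr_eq0 -raddfB -psi_in.
  by rewrite FE raddf0.
exists v => x; have [i xi] := unionS x.
have -> : x = dsum_sum S (dsum_in (Sub x xi : subgrps S i)).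
  by rewrite dsum_sum_in.
by rewrite -dF dsum_sum_in (vE i (Sub x xi)).
Qed.

(** * Indiscreteness of the two topologies *)

Lemma lim1_nbhs (x y : lim1_hom H incS) (U : set (lim1_hom H incS)) :
  nbhs x U -> U y.
Proof.
have [a ->] : exists a, x = lim1_class H incS a by exact: tquot_pi_surj.
have [b ->] : exists b, y = lim1_class H incS b by exact: tquot_pi_surj.
(* [b - Psi (k n)] represents [y] and coincides with [a] in the first [n] coordinates, so it
   converges to [a]. *)
have [k kE] := boolp.choice (fun n => Psi_solve n incS (b - a)).
apply: (@coker_nbhs_limit _ _ _ (fun n => b - Psi incS (k n))).
  apply: cvg_dprod => i; exists i.+1 => // n /= ni.
  by rewrite dprodBE kE// subKr.
move=> n; apply/coker_piP; exists (- k n).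
by rewrite addrAC subrr sub0r raddfN.
Qed.

(** With [theta] representing [c' - c] and [F n] lifting [theta] on [S n], the maps
    [phi + theta - res_push (F n)] all represent [c'] and converge pointwise to [phi]. The sets [U]
    live in [Ext] because [Pext] has the initial topology from there. *)
Lemma pext_nbhs (S_fin_gen : forall i, fin_gen (S i)) (c c' : Pext G R)
    (U : set (Ext G R)) :
  nbhs (\val c) U -> U (\val c').
Proof.
have [phi _ cE] := pext_torsion_lift (valP c).
have [theta thT thE] := pext_torsion_lift (valP (c' - c)).
have [F FE] :=
  boolp.choice (fun i => torsion_lift_fin_gen thT (S_fin_gen i)).
pose chi := (phi : HomZ G (res1 R)) + (theta : HomZ G (res1 R)).
have -> : \val c' = Ext_class G R chi.
  rewrite raddfD -cE -thE -(raddfD (\val : Pext G R -> Ext G R)).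
  by rewrite addrC subrK.
rewrite cE; apply: (@coker_nbhs_limit _ _ _
  (fun n => chi - res_push (F n))).
  apply: cvg_hom => x; have [i xi] := unionS x; exists i => // n ni.
  have xn : x \in S n by exact: (filtration_subset incS ni xi).
  by rewrite homBE [hom_eval (res_push _) _](FE n x xn); exact: addrK.
move=> n; apply/coker_piP; exists (- (F n : HomZ G (res0 R))).
by rewrite addrAC subrr sub0r raddfN.
Qed.

End jensen.

Theorem proposition2p6 (G H : zmodType) (G_ : nat -> zmodClosed G)
    (G_countable : countable [set: G])
    (G_fin_gen : forall i, fin_gen (G_ i))
    (G_incr : forall i, {subset G_ i <= G_ i.+1})
    (G_union : forall x : G, exists i, x \in G_ i)
    (R : inj_resolution H) :
  exists J : Pext G R -> lim1_hom H G_incr,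
    is_jensen J /\ topgroup_iso J.
Proof.
(* [r c] is a chosen preimage of [c] under the connecting map; its class in the cokernel does not
   depend on the choice, by [connecting0P]. *)
have [r rP] := boolp.choice (pext_connecting (R := R) G_incr G_fin_gen).
pose J c := lim1_class H G_incr (hom_dsum_prod (r c)).
have valB (c d : Pext G R) : \val (c - d) = \val c - \val d.
  exact: (raddfB (\val : Pext G R -> Ext G R)).
have jJ : is_jensen J.
  move=> f c.
  have -> : J c = lim1_class H G_incr (hom_dsum_prod f) <->
      lim1_class H G_incr (hom_dsum_prod (r c - f)) = 0.
    rewrite hom_dsum_prodB raddfB -/(J c).
    by split=> [->|/eqP]; rewrite ?subrr// subr_eq0 => /eqP.
  rewrite -(connecting0P R); split=> [fc|rf].
    by rewrite -(subrr (\val c)); apply: connectingB.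
  by rewrite -(subr0 (\val c)) -(subKr (r c) f); apply: connectingB.
have [s sP] : exists s : lim1_hom H G_incr -> Pext G R, cancel s J.
  suff /boolp.choice[s sJ] : forall l, exists c, J c = l by exists s.
  move=> l.
  have [a ->] : exists a, l = lim1_class H G_incr a by exact: tquot_pi_surj.
  have [f ->] := hom_dsum_prod_surj a.
  by have [c fc] := connecting_ex R G_incr G_union f; exists c; apply/jJ.
(* If [J c = J d], then [r c] is connected to both [c] and [d], hence 0 to [c - d], and
   single-valuedness applies. *)
have Jinj : injective J.
  move=> c d cd; apply/eqP; rewrite -subr_eq0; apply/eqP/val_inj.
  rewrite valB; apply: (connecting_0l (incS := G_incr) G_union).
  rewrite -(subrr (r c)); apply: connectingB => //.
  by apply/jJ; rewrite -cd.
exists J; split=> //; split.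
  move=> c d; apply/esym; have := connectingB (rP c) (rP d).
  by rewrite -valB => /jJ ->; rewrite hom_dsum_prodB raddfB.
exists s; split=> //.
- by move=> c; apply: Jinj.
(* Every neighbourhood in the target is the whole group, so its preimage is too; likewise for [s]
   below. *)
- by move=> c U /lim1_nbhs JU; apply: (@filterE _ (nbhs c)) => d; exact: JU.
- apply: (@continuous_comp_initial _ _ _ (\val : Pext G R -> Ext G R)) => l U.
  move=> /(@pext_nbhs _ _ _ _ G_incr G_union G_fin_gen (s l)) sU.
  by apply: (@filterE _ (nbhs l)) => k; exact: sU.
Qed.
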